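(* Let $\Lambda$ be a left hereditary ring such that the injective envelope of the left module ${}_{\Lambda}\Lambda$ is projective. Then the stable category $\Lambda\text{-}\underline{\mathrm{Mod}}$ is well-powered.
   Context: Rings are associative with identity; modules are left modules. The stable category $\Lambda\text{-}\underline{\mathrm{Mod}}$ has all left $\Lambda$-modules as objects; its morphisms are equivalence classes of $\Lambda$-homomorphisms, where $f$ and $g$ are equivalent if $f-g$ factors through a projective module. A category is well-powered if every object $B$ has only a set of subobjects, where subobjects are equivalence classes of monomorphisms with codomain $B$, and monomorphisms $m:A\to B$, $m':A'\to B$ are equivalent if there is an isomorphism $i:A\to A'$ with $m=m'i$. *)

(* Defs.v *)
From HB Require Import structures.
From mathcomp Require Import all_boot all_algebra generic_quotient boolp.

Set Implicit Arguments.
Unset Strict Implicit.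
Unset Printing Implicit Defensive.

Import GRing.Theory.
Local Open Scope ring_scope.
Local Open Scope quotient_scope.

Record category := Category {
  obj :> Type;
  hom : obj -> obj -> Type;
  idm : forall A, hom A A;
  comp : forall A B C, hom B C -> hom A B -> hom A C;
  comp1m : forall A B (f : hom A B), comp (idm B) f = f;
  compm1 : forall A B (f : hom A B), comp f (idm A) = f;
  compA : forall A B C D (h : hom C D) (g : hom B C) (f : hom A B),
    comp h (comp g f) = comp (comp h g) f
}.

Arguments hom {_} A B.
Arguments idm {_} A.
Arguments comp {_ A B C} g f.

Section Subobjects.
Context (C : category).

Definition monic (A B : C) (m : hom A B) : Prop :=
  forall (X : C) (f g : hom X A), comp m f = comp m g -> f = g.

Definition is_iso (A B : C) (i : hom A B) : Prop :=
  exists j : hom B A, comp j i = idm A /\ comp i j = idm B.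

Record mono_into (B : C) := MonoInto {
  mono_dom : C;
  mono_map : hom mono_dom B;
  mono_monic : monic mono_map
}.

Definition mono_equiv (B : C) (m m' : mono_into B) : Prop :=
  exists i : hom (mono_dom m) (mono_dom m'),
    is_iso i /\ mono_map m = comp (mono_map m') i.

Definition subobject (B : C) : Type :=
  {S : mono_into B -> Prop | exists m, S = mono_equiv m}.

End Subobjects.

(* The sets, as opposed to proper classes, are the types of the universe in
   which the carriers of the lmodTypes live. That universe has to be named: if
   it were left to inference, it could be taken large enough to contain
   [lmodType R], and every type would then be small. *)
Definition is_small (T : Type) : Prop :=
  exists (I : Type@{GRing.Lmodule.axioms_.u0}) (f : I -> T), bijective f.

Definition well_powered (C : category) : Prop :=
  forall B : C, is_small (subobject B).

Section Modules.
Context (R : pzRingType).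

Definition surj (A B : Type) (f : A -> B) : Prop := forall y, exists x, f x = y.

Definition projective (P : lmodType R) : Prop :=
  forall (M N : lmodType R) (p : {linear M -> N}) (f : {linear P -> N}),
    surj p -> exists h : {linear P -> M}, forall x, p (h x) = f x.

Definition injective_module (E : lmodType R) : Prop :=
  forall (M N : lmodType R) (i : {linear M -> N}) (f : {linear M -> E}),
    injective i -> exists h : {linear N -> E}, forall x, h (i x) = f x.

Definition essential (M E : lmodType R) (i : {linear M -> E}) : Prop :=
  forall S : {pred E}, submod_closed S ->
    (exists2 y, y \in S & y != 0) -> exists2 x, i x \in S & i x != 0.

Definition injective_envelope (M E : lmodType R) (i : {linear M -> E}) : Prop :=
  [/\ injective_module E, injective i & essential i].

(* A left ideal is a submodule of R^o, the regular left module. *)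
Definition left_hereditary : Prop :=
  forall (S : {pred R^o}) (I : subLmodType S), projective I.

Definition factors_through_projective (A B : lmodType R) (f : A -> B) : Prop :=
  exists2 P : lmodType R, projective P &
    exists (u : {linear A -> P}) (v : {linear P -> B}), forall x, f x = v (u x).

Definition stable_equiv (A B : lmodType R) (f g : {linear A -> B}) : Prop :=
  factors_through_projective (f \- g).

Lemma projective0 : projective 'rV[R]_0.
Proof.
move=> M N p f _; exists \0 => x.
by rewrite /= (_ : x = 0) ?linear0 //; apply/matrixP => i [].
Qed.

Lemma projective_prod (P Q : lmodType R) :
  projective P -> projective Q -> projective (P * Q)%type.
Proof.
move=> hP hQ M N p f sp.
pose fP (x : P) : N := f (x, 0); pose fQ (x : Q) : N := f (0, x).
have lP : linear fP.
  move=> a x y; rewrite /fP -linearP; congr (f _).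
  by congr pair; rewrite /= scaler0 addr0.
have lQ : linear fQ.
  move=> a x y; rewrite /fQ -linearP; congr (f _).
  by congr pair; rewrite /= scaler0 addr0.
pose FP := GRing.isLinear.Build _ _ _ _ fP lP.
pose FQ := GRing.isLinear.Build _ _ _ _ fQ lQ.
pose gP : {linear P -> N} := HB.pack fP FP.
pose gQ : {linear Q -> N} := HB.pack fQ FQ.
have [h1 e1] := hP _ _ p gP sp; have [h2 e2] := hQ _ _ p gQ sp.
exists ((h1 \o fst) \+ (h2 \o snd)) => -[x y] /=.
rewrite linearD e1 e2 /= /fP /fQ -linearD; congr (f _).
by congr pair; rewrite /= ?addr0 ?add0r.
Qed.

Lemma stable_equiv_refl (A B : lmodType R) (f : {linear A -> B}) :
  stable_equiv f f.
Proof.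
exists 'rV[R]_0; first exact: projective0.
by exists \0, \0 => x /=; rewrite subrr.
Qed.

Lemma stable_equiv_sym (A B : lmodType R) (f g : {linear A -> B}) :
  stable_equiv f g -> stable_equiv g f.
Proof.
case=> P hP [u [v e]]; exists P => //; exists u, (\- v) => x /=.
by rewrite -e /= opprB.
Qed.

Lemma stable_equiv_trans (A B : lmodType R) (f g h : {linear A -> B}) :
  stable_equiv f g -> stable_equiv g h -> stable_equiv f h.
Proof.
case=> P hP [u [v e]] [Q hQ [u' [v' e']]].
exists (P * Q)%type; first exact: projective_prod.
pose w (x : A) : P * Q := (u x, u' x).
have lw : linear w by move=> a x y; rewrite /w !linearP.
pose W := GRing.isLinear.Build _ _ _ _ w lw.
pose ww : {linear A -> (P * Q)%type} := HB.pack w W.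
exists ww, ((v \o fst) \+ (v' \o snd)) => x /=.
by rewrite -e -e' /= addrA subrK.
Qed.

Lemma stable_equiv_comp (A B C : lmodType R)
    (f f' : {linear A -> B}) (g g' : {linear B -> C}) :
  stable_equiv f f' -> stable_equiv g g' -> stable_equiv (g \o f) (g' \o f').
Proof.
case=> P hP [u [v e]] [Q hQ [u' [v' e']]].
apply: (@stable_equiv_trans _ _ _ (g \o f')).
  by exists P => //; exists u, (g \o v) => x /=; rewrite -e /= linearB.
by exists Q => //; exists (u' \o f'), v' => x /=; rewrite -e'.
Qed.

HB.instance Definition _ (A B : lmodType R) := gen_eqMixin {linear A -> B}.
HB.instance Definition _ (A B : lmodType R) := gen_choiceMixin {linear A -> B}.

Definition stable_rel (A B : lmodType R) : rel {linear A -> B} :=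
  fun f g => `[< stable_equiv f g >].

Lemma stable_rel_refl (A B : lmodType R) : reflexive (@stable_rel A B).
Proof. by move=> f; apply/asboolP/stable_equiv_refl. Qed.

Lemma stable_rel_sym (A B : lmodType R) : symmetric (@stable_rel A B).
Proof. by move=> f g; apply/asboolP/asboolP; apply: stable_equiv_sym. Qed.

Lemma stable_rel_trans (A B : lmodType R) : transitive (@stable_rel A B).
Proof.
by move=> g f h /asboolP e /asboolP e'; apply/asboolP/(stable_equiv_trans e).
Qed.

Canonical stable_equiv_rel (A B : lmodType R) :=
  EquivRel (@stable_rel A B) (@stable_rel_refl A B) (@stable_rel_sym A B)
    (@stable_rel_trans A B).

Definition stable_hom (A B : lmodType R) : Type :=
  {eq_quot (@stable_equiv_rel A B)}.

Definition stable_class (A B : lmodType R) (f : {linear A -> B}) :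
  stable_hom A B := \pi_({eq_quot (@stable_equiv_rel A B)}) f.

Definition stable_repr (A B : lmodType R) (f : stable_hom A B) :
  {linear A -> B} := repr (f : {eq_quot (@stable_equiv_rel A B)}).

Lemma stable_classP (A B : lmodType R) (f g : {linear A -> B}) :
  stable_class f = stable_class g <-> stable_equiv f g.
Proof.
split=> [e|e]; last by apply/eqmodP/asboolP.
by apply/asboolP; move/eqmodP: e.
Qed.

Lemma stable_reprK (A B : lmodType R) (f : stable_hom A B) :
  stable_class (stable_repr f) = f.
Proof. exact: reprK. Qed.

Lemma stable_classK (A B : lmodType R) (f : {linear A -> B}) :
  stable_equiv (stable_repr (stable_class f)) f.
Proof. by apply/stable_classP; rewrite stable_reprK. Qed.

Definition stable_id (A : lmodType R) : stable_hom A A := stable_class idfun.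

Definition stable_comp (A B C : lmodType R)
    (g : stable_hom B C) (f : stable_hom A B) : stable_hom A C :=
  stable_class (stable_repr g \o stable_repr f).

Lemma stable_compE (A B C : lmodType R)
    (g : {linear B -> C}) (f : {linear A -> B}) :
  stable_comp (stable_class g) (stable_class f) = stable_class (g \o f).
Proof. by apply/stable_classP/stable_equiv_comp; apply: stable_classK. Qed.

Lemma stable_comp1m (A B : lmodType R) (f : stable_hom A B) :
  stable_comp (stable_id B) f = f.
Proof.
rewrite -(stable_reprK f) stable_compE; apply/stable_classP.
exact: stable_equiv_refl.
Qed.

Lemma stable_compm1 (A B : lmodType R) (f : stable_hom A B) :
  stable_comp f (stable_id A) = f.
Proof.
rewrite -(stable_reprK f) stable_compE; apply/stable_classP.
exact: stable_equiv_refl.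
Qed.

Lemma stable_compA (A B C D : lmodType R) (h : stable_hom C D)
    (g : stable_hom B C) (f : stable_hom A B) :
  stable_comp h (stable_comp g f) = stable_comp (stable_comp h g) f.
Proof.
rewrite -(stable_reprK f) -(stable_reprK g) -(stable_reprK h) !stable_compE.
by apply/stable_classP; apply: stable_equiv_refl.
Qed.

Definition stable_category : category :=
  Category stable_comp1m stable_compm1 stable_compA.

End Modules.

(* Main.v *)
(* Let f : A -> B represent a stable monomorphism, with kernel K. The inclusion
   of K in A is stably zero, so K embeds in a projective module and is itself
   projective because R is hereditary. Expanding the elements of K over a dual
   basis and closing a set of preimages of f(A) under linear combinations and
   under these expansions gives a submodule A0 of A, of cardinality bounded in
   terms of B and R only, such that f(A0) = f(A) and A0 /\ K is a direct summand
   of K. Then A is the sum of A0 and a complement of A0 /\ K in K, so the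
   inclusion of A0 in A is a stable isomorphism. *)
From HB Require Import structures.
From mathcomp Require Import all_boot all_algebra.
From mathcomp Require Import boolp classical_sets functions.
Require Import Defs.
Set Implicit Arguments.
Unset Strict Implicit.
Unset Printing Implicit Defensive.
Import GRing.Theory.
Local Open Scope ring_scope.

(** * Finitely supported sums, coordinates and projectivity *)

Lemma sum_support (V : nmodType) (I : eqType) (F : I -> V) (s t : seq I) :
    uniq s -> uniq t -> (forall i, i \notin s -> F i = 0) ->
    (forall i, i \notin t -> F i = 0) ->
  \sum_(i <- s) F i = \sum_(i <- t) F i.
Proof.
move=> us ut hs ht.
have dropz (r : seq I) : \sum_(i <- r) F i = \sum_(i <- r | F i != 0) F i.
  by rewrite [RHS]big_mkcond; apply: eq_bigr => i _; case: eqP.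
rewrite dropz [RHS]dropz -big_filter -[RHS]big_filter; apply: perm_big.
apply: uniq_perm; rewrite ?filter_uniq // => i; rewrite !mem_filter.
have [//|/= nz] := eqVneq (F i) 0.
by case: (boolP (i \in s)) (contra_neqT (hs i) nz) => // _ _;
  case: (boolP (i \in t)) (contra_neqT (ht i) nz).
Qed.

Section Modules.
Variable R : pzRingType.

Definition linear_of (U V : lmodType R) (f : U -> V) (lf : linear f) :
  {linear U -> V} := HB.pack f (GRing.isLinear.Build R U V _ f lf).

Definition submodule (V : lmodType R) (S : {pred V}) (hS : submod_closed S) :
    subLmodType S :=
  HB.pack {x | x \in S} (GRing.SubChoice_isSubLmodule.Build R V S {x | x \in S}
    (GRing.submod_closed_semi hS)).

Lemma val_lin (V : lmodType R) (S : {pred V}) (W : subLmodType S) a (x y : W) :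
  val (a *: x + y) = a *: val x + val y.
Proof. exact: (linearP (val : {linear W -> V})). Qed.

(** The list [s x] need only contain the support of [x], so it can be pulled back along linear
    maps. *)
Definition finite_coordinates (K : lmodType R) (I : eqType) (c : K -> I -> R)
    (s : K -> seq I) : Prop :=
  (forall a x y i, c (a *: x + y) i = a * c x i + c y i) /\
  (forall x i, i \notin s x -> c x i = 0) /\ (forall x, uniq (s x)).

(** The lists of [x], [y] and [a *: x + y] can be replaced by one common list, since the added terms
    vanish. *)
Lemma coordinate_sum_linear (K M : lmodType R) (I : eqType) (c : K -> I -> R)
    (s : K -> seq I) (v : I -> M) : finite_coordinates c s ->
  linear (fun x => \sum_(i <- s x) c x i *: v i).
Proof.
move=> [lc [hs us]] a x y; pose t := undup (s x ++ s y ++ s (a *: x + y)).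
have sumE z : {subset s z <= t} ->
    \sum_(i <- s z) c z i *: v i = \sum_(i <- t) c z i *: v i.
  move=> st; apply: sum_support => // [|i /hs->|i ti]; rewrite ?undup_uniq //.
    by rewrite scale0r.
  by rewrite hs ?scale0r //; apply: contra ti => /st.
rewrite !sumE; try by move=> i hi; rewrite mem_undup !mem_cat hi ?orbT.
rewrite scaler_sumr -big_split; apply: eq_bigr => i _ /=.
by rewrite lc scalerDl scalerA.
Qed.

(** Dual basis with all elements of [P] as generators: the free module on the set [P] maps onto [P],
    and a section of this map supplies the coordinates. *)
Lemma projective_coordinates (P : lmodType R) : projective P ->
  exists (c : P -> P -> R) (s : P -> seq P),
    finite_coordinates c s /\ forall x, x = \sum_(y <- s x) c x y *: y.
Proof.
move=> hP.
pose finite_support (f : P -> R^o) :=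
  exists s : seq P, forall i, i \notin s -> f i = 0.
pose S : {pred P -> R^o} := fun f => `[< finite_support f >].
have hS : submod_closed S.
  split=> [|a f g /asboolP[s hs] /asboolP[t ht]]; apply/asboolP.
    by exists [::].
  exists (s ++ t) => i; rewrite mem_cat negb_or => /andP[/hs fi /ht gi].
  by rewrite !fctE fi gi scaler0 addr0.
pose F := submodule hS.
pose coord (f : F) (y : P) : R := val f y.
have coordE a f g y : coord (a *: f + g) y = a * coord f y + coord g y.
  by rewrite /coord linearP !fctE.
have suppF (f : F) :
    {s : seq P | uniq s & forall i, i \notin s -> coord f i = 0}.
  apply: cid2; have /asboolP[s hs] := valP f.
  by exists (undup s) => [|i]; rewrite ?undup_uniq // mem_undup; apply: hs.
pose s f := s2val (suppF f).
have cs : finite_coordinates coord s.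
  split=> //; split=> x; first exact: (s2valP' (suppF x)).
  exact: (s2valP (suppF x)).
have le := coordinate_sum_linear idfun cs.
have se : surj (linear_of le).
  move=> y.
  pose dlt (i : P) : R^o := (i == y)%:R.
  have dy : dlt \in S.
    by apply/asboolP; exists [:: y] => i; rewrite inE /dlt => /negPf->.
  pose d : F := Sub dlt dy.
  have coord_dy i : coord d i = (i == y)%:R by rewrite /coord SubK.
  have [_ [hs us]] := cs; exists d => /=.
  rewrite (sum_support (t := [:: y])) // => [|i /hs->|i]; rewrite ?scale0r //.
    by rewrite big_seq1 coord_dy eqxx scale1r.
  by rewrite inE coord_dy => /negPf->; rewrite scale0r.
have [h hK] := hP _ _ _ idfun se.
have [_ [hs us]] := cs; exists (coord \o h), (s \o h); split.
  split=> [a x y i|]; first by rewrite /= linearP coordE.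
  by split=> x; [apply: hs | apply: us].
by move=> x; rewrite -[LHS]hK.
Qed.

(* Any lift defined on the elements supported in a set [Z] of indices extends
   to one more index [b], because the [b]-coordinates of the elements supported
   in [Z] and [b] form a left ideal; Zorn's lemma then reaches all indices. *)
Lemma finite_coordinates_projective (K : lmodType R) (I : eqType)
    (c : K -> I -> R) (s : K -> seq I) : left_hereditary R ->
  finite_coordinates c s -> (forall x, c x =1 (fun=> 0) -> x = 0) ->
  projective K.
Proof.
move=> hR [lc [hs _]] cI M N p g sp.
pose supported (Z : I -> Prop) x := forall i, c x i != 0 -> Z i.
have supported_lin Z a x y : supported Z x -> supported Z y ->
    supported Z (a *: x + y).
  move=> hx hy i; rewrite lc.
  have [cx|/hx//] := eqVneq (c x i) 0; have [cy|/hy//] := eqVneq (c y i) 0.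
  by rewrite cx cy mulr0 addr0 eqxx.
have c0 i : c 0 i = 0.
  by have := lc (-1) 0 0 i; rewrite scaler0 addr0 mulN1r addNr.
have supported0 Z : supported Z 0 by move=> i; rewrite c0 eqxx.
(* The map is total on [K] but constrained only on elements supported in [Zh.1], which avoids
   varying domains. *)
pose is_lift (Zh : (I -> Prop) * (K -> M)) :=
  (forall a x y, supported Zh.1 x -> supported Zh.1 y ->
     Zh.2 (a *: x + y) = a *: Zh.2 x + Zh.2 y) /\
  (forall x, supported Zh.1 x -> p (Zh.2 x) = g x).
pose lift := {Zh | is_lift Zh}.
pose dom (u : lift) := (sval u).1; pose fn (u : lift) := (sval u).2.
pose le_lift (u v : lift) := `[<(forall i, dom u i -> dom v i) /\
  (forall x, supported (dom u) x -> fn v x = fn u x)>].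
have lift0 : is_lift (fun=> False, fun=> 0).
  split=> [a x y _ _|x hx] /=; first by rewrite scaler0 addr0.
  rewrite (cI x) ?linear0 // => i; apply/eqP/negPn/negP; exact: hx.
have sub_supported (u v : lift) x : le_lift u v -> supported (dom u) x ->
  supported (dom v) x by move=> /asboolP[h _] hx i /hx/h.
have [||A totA|[[Z h] [/= lh ph]] maxZ] :=
    ZL_preorder (exist _ _ lift0 : lift) (R := le_lift).
- by move=> u; apply/asboolP.
- move=> u v w uv vw; apply/asboolP; split=> [i|x hx].
    by move/asboolP: uv => [+ _] => /[apply]; move/asboolP: vw => [+ _]; apply.
  have hvx := sub_supported _ _ _ uv hx.
  by move/asboolP: uv => [_ <-] //; move/asboolP: vw => [_ ->].
- have [->|/set0P[u0 Au0]] := eqVneq A set0.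
    by exists (exist _ _ lift0).
  pose W i := exists2 u, A u & dom u i.
  (* Supports are finite, so each identity to check on the union of the chain already lives in one
     member. *)
  have chain_seq (r : seq I) :
      exists2 u, A u & forall i, i \in r -> W i -> dom u i.
    elim: r => [|i r [u Au hu]]; first by exists u0.
    have [[v Av vi]|nWi] := pselect (W i); last first.
      by exists u => // j; rewrite inE => /orP[/eqP->|/hu].
    have [uv|vu] := totA u v Au Av.
      exists v => // j; rewrite inE => /orP[/eqP->//|/hu uj] /uj.
      by move/asboolP: uv => [+ _]; apply.
    exists u => // j; rewrite inE => /orP[/eqP-> _|/hu//].
    by move/asboolP: vu => [+ _]; apply.
  have chain2 x y : supported W x -> supported W y ->
      exists u, [/\ A u, supported (dom u) x & supported (dom u) y].
    move=> hx hy; have [u Au hu] := chain_seq (s x ++ s y).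
    exists u; split=> // i nz; (apply: hu; [rewrite mem_cat | auto]).
      by rewrite (contra_neqT (hs x i) nz).
    by rewrite (contra_neqT (hs y i) nz) orbT.
  pose h x := if pselect (exists2 u, A u & supported (dom u) x) is left ex
    then fn (s2val (cid2 ex)) x else 0.
  have hE u x : A u -> supported (dom u) x -> h x = fn u x.
    move=> Au ux; rewrite /h; case: pselect => [ex|[]]; last by exists u.
    case: (cid2 ex) => v Av vx /=.
    have [/asboolP[_ ->//]|/asboolP[_ ->//]] := totA u v Au Av.
  have lift_h : is_lift (W, h).
    split=> [a x y hx hy|x hx] /=.
      have [u [Au ux uy]] := chain2 _ _ hx hy.
      rewrite !(hE u) //; last exact: supported_lin.
      exact: (svalP u).1.
    have [u [Au ux _]] := chain2 _ _ hx hx.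
    by rewrite (hE u) //; apply: (svalP u).2.
  exists (exist _ _ lift_h : lift) => u Au; apply/asboolP.
  by split=> [i ui|x ux]; [exists u | apply: hE].
have Zall b : Z b.
  have [//|nZb] := pselect (Z b).
  pose Z' i := Z i \/ i = b.
  pose D : {pred K} := fun x => `[< supported Z' x >].
  have hD : submod_closed D.
    split=> [|a x y /asboolP hx /asboolP hy]; apply/asboolP.
      exact: supported0.
    exact: supported_lin.
  pose D' := submodule hD.
  pose cb (d : D') : R^o := c (val d) b.
  have lcb a d d' : cb (a *: d + d') = a *: cb d + cb d'.
    by rewrite /cb linearP lc.
  (* This left ideal is projective, which is used twice: to split [pi] and to lift [g] along the
     section. *)
  pose J : {pred R^o} := fun a => `[< exists d, cb d = a >].
  have hJ : submod_closed J.
    split=> [|a x y /asboolP[d <-] /asboolP[d' <-]]; apply/asboolP.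
      by exists 0; rewrite /cb linear0 c0.
    by exists (a *: d + d'); rewrite lcb.
  pose J' := submodule hJ.
  have cbJ d : cb d \in J by apply/asboolP; exists d.
  pose pi (d : D') : J' := Sub (cb d) (cbJ d).
  have val_pi d : val (pi d) = cb d by rewrite /pi SubK.
  have lpi : linear pi.
    by move=> a d d'; apply: val_inj; rewrite linearP !val_pi lcb.
  have spi : surj pi.
    move=> j; have /asboolP[d dj] := valP j.
    by exists d; apply: val_inj; rewrite val_pi.
  have [sg sgK] := hR _ J' _ _ (linear_of lpi) idfun spi.
  have [l lE] := hR _ J' _ _ p (g \o val \o sg) sp.
  (* Subtracting the part along the section kills the [b]-coordinate and leaves an element on which
     [h] is a lift. *)
  pose q d := d - sg (pi d).
  have lq : linear q.
    move=> a d d'; rewrite /q lpi linearP scalerBr opprD !addrA.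
    by congr (_ - _); rewrite addrAC.
  have qZ d : supported Z (val (q d)).
    have qb : c (val (q d)) b = 0.
      have : cb (q d) = 0; last by [].
      rewrite /q addrC -scaleN1r lcb -!val_pi.
      have -> : pi (sg (pi d)) = pi d by apply: sgK.
      by rewrite scaleN1r addNr.
    move=> i; have [->|ib nz] := eqVneq i b; first by rewrite qb eqxx.
    have /asboolP := valP (q d).
    by case/(_ _ nz) => // eib; rewrite eib eqxx in ib.
  pose hD' d := h (val (q d)) + l (pi d).
  pose h' x := if insub x is Some d then hD' d else 0.
  have hE x (Dx : x \in D) : h' x = hD' (Sub x Dx) by rewrite /h' insubT.
  have lift_h : is_lift (Z', h').
    split=> [a x y hx hy|x hx] /=.
      have Dx : x \in D by apply/asboolP.
      have Dy : y \in D by apply/asboolP.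
      have Dxy : a *: x + y \in D by apply/asboolP; apply: supported_lin.
      rewrite (hE _ Dx) (hE _ Dy) (hE _ Dxy).
      have -> : Sub (a *: x + y) Dxy = a *: Sub x Dx + Sub y Dy :> D'.
        by apply: val_inj; rewrite linearP !SubK.
      rewrite /hD' lq lpi !linearP lh; try exact: qZ.
      by rewrite scalerDr addrACA.
    have Dx : x \in D by apply/asboolP.
    rewrite (hE _ Dx) linearD ph; last exact: qZ.
    by rewrite lE /q /= !linearB /= subrK.
  (* Maximality then forces [Z'] into [Z], and [b] satisfies [Z']. *)
  suff /maxZ : le_lift (exist _ (Z, h) (conj lh ph)) (exist _ _ lift_h).
    by move=> /asboolP[/(_ b) + _]; apply; right.
  apply/asboolP; split=> [i /= Zi|x /= hx]; first by left.
  have Dx : x \in D by apply/asboolP => i /hx; left.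
  have pi0 : pi (Sub x Dx) = 0.
    apply: val_inj; rewrite val_pi linear0 /cb SubK.
    by apply/eqP/negPn/negP => /hx.
  by rewrite /fn /= (hE _ Dx) /hD' /q pi0 !linear0 !addr0 SubK.
have supp x : supported Z x by move=> i _.
have lh' : linear h by move=> a x y; apply: (lh).
by exists (linear_of lh') => x; apply: (ph).
Qed.

(** * Kernels of stable monomorphisms and reduction to a bounded submodule *)

Lemma stable_class_eq (A B : lmodType R) (f g : {linear A -> B}) :
  f =1 g -> stable_class f = stable_class g.
Proof.
move=> fg; apply/stable_classP; exists 'rV[R]_0; first exact: projective0.
by exists \0, \0 => x /=; rewrite fg subrr.
Qed.

Lemma kernel_closed (A B : lmodType R) (f : {linear A -> B}) :
  submod_closed [pred x | f x == 0].
Proof.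
split=> [|a x y]; rewrite !inE ?linear0 // => /eqP fx /eqP fy.
by rewrite linearP fx fy scaler0 addr0.
Qed.

Definition kernel (A B : lmodType R) (f : {linear A -> B}) :=
  submodule (kernel_closed f).

Lemma kernelP (A B : lmodType R) (f : {linear A -> B}) (k : kernel f) :
  f (val k) = 0.
Proof. exact/eqP/(valP k). Qed.

(** The inclusion of the kernel and the zero map agree after composition with [f], so the inclusion
    factors as [v \o u] through a projective [P]. Hence the coordinates of [P], pulled back along
    [u], detect zero. *)
Lemma monic_kernel_projective (A B : lmodType R) (f : {linear A -> B}) :
  left_hereditary R -> @monic (stable_category R) A B (stable_class f) ->
  projective (kernel f).
Proof.
move=> hR mf.
have : stable_class (val : {linear kernel f -> A}) = stable_class \0.
  apply: mf; rewrite /= !stable_compE; apply: stable_class_eq => k /=.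
  by rewrite kernelP linear0.
move=> /stable_classP[P hP [u [v uv]]].
have [c [s [[lc [hs us]] xE]]] := projective_coordinates hP.
apply: (finite_coordinates_projective (c := c \o u) (s := s \o u)) => //.
  split=> [a x y i|]; first by rewrite /= linearP lc.
  by split=> x; [apply: hs | apply: us].
move=> k ck; apply: val_inj; rewrite linear0 -[LHS]subr0 [LHS]uv (xE (u k)).
by rewrite big1 ?linear0 // => i _; rewrite [c _ _]ck scale0r.
Qed.

(** The second argument of [Coordinate] is a position in a list of generators rather than a
    generator, so that terms do not refer to [A]. *)
Inductive term (B C : Type) : Type :=
  | Preimage of B
  | Lin of C & term B C & term B C
  | Coordinate of term B C & nat.

(* The values of the terms form a submodule of [A] that contains a preimage of
   every element of the image of [f] and, with each element of the kernel [K],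
   the elements of [K] used to expand it; the latter makes the intersection
   with [K] a direct summand of [K]. *)
Lemma stable_reduction (A B : lmodType R) (f : {linear A -> B}) :
  left_hereditary R -> @monic (stable_category R) A B (stable_class f) ->
  exists (A0 : lmodType R) (j : {linear A0 -> A}) (ev : term B R -> A0),
    [/\ surj ev,
        forall a t t', ev (Lin a t t') = a *: ev t + ev t' &
        @is_iso (stable_category R) A0 A (stable_class j)].
Proof.
move=> hR mf; pose K := kernel f.
have hK : projective K by apply: monic_kernel_projective.
have [c [s [cs xE]]] := projective_coordinates hK.
pose pre (b : B) : A := if pselect (exists x, f x = b) is left ex
  then sval (cid ex) else 0.
have preE x : f (pre (f x)) = f x.
  by rewrite /pre; case: pselect => [ex|[]]; [case: (cid ex) | exists x].
(* [Coordinate] yields [0] when the value of [t] is outside the kernel or the position is past the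
   end of the list. *)
pose fix eval (t : term B R) : A := match t with
  | Preimage b => pre b
  | Lin a t t' => a *: eval t + eval t'
  | Coordinate t n =>
      if insub (eval t) is Some k then val (nth 0 (s (k : K)) n) else 0
  end.
pose S : {pred A} := fun x => `[< exists t, eval t = x >].
have S_eval t : eval t \in S by apply/asboolP; exists t.
have S_lin a x y : x \in S -> y \in S -> a *: x + y \in S.
  by move=> /asboolP[t <-] /asboolP[t' <-]; apply: (S_eval (Lin a t t')).
have hS : submod_closed S.
  split=> //; pose x := eval (Preimage _ 0); have Sx : x \in S by apply: S_eval.
  by have := S_lin (-1) _ _ Sx Sx; rewrite scaleN1r addNr.
have S_support (k : K) i : val k \in S -> i \in s k -> val i \in S.
  move=> /asboolP[t tk] ik; have := S_eval (Coordinate t (index i (s k))).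
  by rewrite /= tk valK nth_index.
pose A0 := submodule hS.
have valB (x y : K) : val (x - y) = val x - val y by rewrite linearB.
(* Keeping only the generators in [S] makes [r] a linear retraction of [K] onto its intersection
   with [S]. *)
pose v (i : K) : K := if val i \in S then i else 0.
pose r := linear_of (coordinate_sum_linear v cs).
have rS (k : K) : val (r k) \in S.
  have [S0 _] := hS.
  rewrite (linear_sum (val : {linear K -> A})).
  elim/big_ind: _ => // [x y Sx Sy|i _].
    by rewrite -[x]scale1r; apply: S_lin.
  rewrite linearZ /= /v -[_ *: _]addr0; apply: S_lin => //.
  by case: ifP => // _; rewrite linear0.
have r_id (k : K) : val k \in S -> r k = k.
  move=> Sk; rewrite [RHS]xE /=; apply: eq_big_seq => i /(S_support _ _ Sk).
  by rewrite /v => ->.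
have k_ker x : x - pre (f x) \in [pred x | f x == 0].
  by rewrite inE linearB preE subrr.
pose k x : K := Sub (x - pre (f x)) (k_ker x).
have val_k x : val (k x) = x - pre (f x) by rewrite SubK.
have S_pre b : pre b \in S by apply: (S_eval (Preimage _ b)).
(* The component of [x] in the complement [ker r]. It is linear although [pre] need not be: by [qE],
   any [y] in [K] congruent to [x] modulo [S] gives the same value. *)
pose q x := k x - r (k x).
have qE x (y : K) : x - val y \in S -> q x = y - r y.
  move=> Sxy; have Sky : val (k x - y) \in S.
    rewrite valB val_k addrAC -[- pre _]scaleN1r addrC; exact: S_lin.
  have rkx : r (k x) = k x - y + r y by rewrite -(r_id _ Sky) linearB subrK.
  by rewrite /q rkx opprD opprB addrA [k x + _]addrC subrK.
have lq : linear q.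
  move=> a x y; rewrite (qE _ (a *: k x + k y)).
    by rewrite linearP scalerBr opprD addrACA.
  rewrite val_lin !val_k.
  have -> : a *: x + y - (a *: (x - pre (f x)) + (y - pre (f y))) =
      a *: pre (f x) + pre (f y).
    by rewrite opprD addrACA scalerBr !opprB !(addrC _ (_ - _)) !subrK.
  exact: S_lin.
pose lq' := linear_of lq.
have p_S x : x - val (q x) \in S.
  have -> : x - val (q x) = 1 *: pre (f x) + val (r (k x)).
    by rewrite valB val_k scale1r !opprB addrCA [x + _]addrC subrK addrC.
  exact: S_lin.
pose p x : A0 := Sub (x - val (q x)) (p_S x).
have val_p x : val (p x) = x - val (q x) by rewrite SubK.
have lp : linear p.
  move=> a x y; apply: val_inj; rewrite val_lin !val_p lq val_lin.
  by rewrite (scalerBr a x) opprD addrACA.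
pose ev t : A0 := Sub (eval t) (S_eval t).
have val_ev t : val (ev t) = eval t by rewrite SubK.
exists A0, (val : {linear A0 -> A}), ev.
split.
- move=> y; have /asboolP[t ty] := valP y.
  by exists t; apply: val_inj; rewrite val_ev.
- by move=> a t t'; apply: val_inj; rewrite val_lin !val_ev.
(* [p] fixes [A0] because [q] vanishes on [S]; on [A] it differs from the identity by [q], which
   factors through the projective [K]. *)
exists (stable_class (linear_of lp)); split; rewrite /= stable_compE.
  apply: stable_class_eq => y; apply: val_inj; apply: etrans (val_p _) _.
  have val0 : val (0 : K) = 0 by rewrite linear0.
  rewrite (qE _ 0); first by rewrite (linear0 r) subr0 val0 subr0.
  by rewrite val0 subr0; apply: valP.
apply/stable_classP/stable_equiv_sym; exists K => //.
exists lq', val => x; apply: etrans (congr1 (+%R x \o -%R) (val_p x)) _.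
by rewrite /= opprB addrC subrK.
Qed.

End Modules.

(** * Equivalence of monomorphisms, and smallness *)

Section Category.
Variable C : category.

Lemma is_iso_comp (X Y Z : C) (g : hom Y Z) (f : hom X Y) :
  is_iso g -> is_iso f -> is_iso (comp g f).
Proof.
move=> [g' [g'g gg']] [f' [f'f ff']]; exists (comp f' g'); split.
  by rewrite -compA [comp g' _]compA g'g comp1m.
by rewrite -compA [comp f _]compA ff' comp1m.
Qed.

Lemma mono_equiv_sym (B : C) (m m' : mono_into B) :
  mono_equiv m m' -> mono_equiv m' m.
Proof.
move=> [i [[j [ji ij]] mE]]; exists j; rewrite mE -compA ij compm1.
by split=> //; exists i.
Qed.

Lemma mono_equiv_trans (B : C) (m m' m'' : mono_into B) :
  mono_equiv m m' -> mono_equiv m' m'' -> mono_equiv m m''.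
Proof.
move=> [i [iso_i mE]] [j [iso_j mE']]; exists (comp j i).
rewrite compA -mE' mE.
by split=> //; apply: is_iso_comp.
Qed.

Lemma mono_equiv_eq (B : C) (m m' : mono_into B) :
  mono_equiv m m' -> mono_equiv m = mono_equiv m'.
Proof.
move=> mm'; apply: funext => n; apply: propext; split.
  exact/mono_equiv_trans/mono_equiv_sym.
exact: mono_equiv_trans.
Qed.

End Category.

(** The image of [g] is a subtype of [T], hence small even if [X] lives in a larger universe. *)
Lemma injective_small (X : Type) (T : Type@{GRing.Lmodule.axioms_.u0})
  (g : X -> T) : injective g -> is_small X.
Proof.
move=> gI; pose I := {t : T | exists x, g x = t}.
exists I, (fun t : I => sval (cid (svalP t))).
exists (fun x => exist _ (g x) (ex_intro _ x erefl) : I) => [t|x].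
  by case: (cid _) => x gx; case: t gx => t ex gx; apply: eq_exist.
by apply: gI; case: (cid _).
Qed.

(** * Codes for subobjects, built from [B] and [R] alone *)

Section Codes.
Variables (R : pzRingType) (B : lmodType R).

(** Equality of the values of terms determines [A0] up to isomorphism; the second component
    determines the map from it to [B]. *)
Definition subobject_code : Type :=
  ((term B R -> term B R -> bool) * (term B R -> B))%type.

Definition encodes (A : lmodType R) (f : {linear A -> B})
    (k : subobject_code) : Prop :=
  exists (A0 : lmodType R) (j : {linear A0 -> A}) (ev : term B R -> A0),
    [/\ surj ev, forall a t t', ev (Lin a t t') = a *: ev t + ev t',
        @is_iso (stable_category R) A0 A (stable_class j) &
        k = (fun t t' => ev t == ev t', fun t => f (j (ev t)))].

(** A common code presents [A0] and [A1] as the same quotient of the terms, with the same map to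
    [B]. *)
Lemma encodes_iso (A A' : lmodType R) (f : {linear A -> B})
    (f' : {linear A' -> B}) k : encodes f k -> encodes f' k ->
  exists i : stable_hom A A', @is_iso (stable_category R) A A' i /\
    stable_class f = stable_comp (stable_class f') i.
Proof.
move=> [A0 [j [ev [sev lev [j' [j'j jj']] ->]]]].
move=> [A1 [l [ew [sew lew [l' [l'l ll']] [eqE fE]]]]].
have evE t t' : (ev t == ev t') = (ew t == ew t').
  by move/(congr1 (fun e => e t t')): eqE.
have fjE t : f (j (ev t)) = f' (l (ew t)) by move/(congr1 (@^~ t)): fE.
(* By [evE], the values transported between [A0] and [A1] do not depend on the terms chosen here. *)
have [tm tmK] := choice sev; have [tn tnK] := choice sew.
have w_ev t : ew (tm (ev t)) = ew t by apply/eqP; rewrite -evE tmK.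
have w'_ew t : ev (tn (ew t)) = ev t by apply/eqP; rewrite evE tnK.
have lw : linear (ew \o tm).
  move=> a x y; rewrite -[x]tmK -[y]tmK -lev /= !w_ev; exact: lew.
have lw' : linear (ev \o tn).
  move=> a x y; rewrite -[x]tnK -[y]tnK -lew /= !w'_ew; exact: lev.
pose w := linear_of lw; pose w' := linear_of lw'.
have iso_w : @is_iso (stable_category R) A0 A1 (stable_class w).
  exists (stable_class w'); rewrite /= !stable_compE.
  split; apply: stable_class_eq => x /=.
    by rewrite w'_ew tmK.
  by rewrite w_ev tnK.
have fw : stable_comp (stable_class f')
      (stable_comp (stable_class l) (stable_class w)) =
    stable_comp (stable_class f) (stable_class j).
  rewrite !stable_compE; apply: stable_class_eq => x /=.
  by rewrite -[x in RHS]tmK fjE.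
(* From [A] back to [A0], across to [A1], then into [A']. *)
exists (stable_comp (stable_comp (stable_class l) (stable_class w)) j'); split.
  apply: (@is_iso_comp (stable_category R)); last by exists (stable_class j).
  by apply: (@is_iso_comp (stable_category R)) => //; exists l'.
rewrite stable_compA fw -stable_compA.
have /= -> := jj'; exact/esym/stable_compm1.
Qed.

End Codes.

Theorem corollary7p5 (R : pzRingType) (hR : left_hereditary R)
    (E : lmodType R) (i : {linear R^o -> E})
    (hE : injective_envelope i) (hP : projective E) :
  well_powered (stable_category R).
Proof.
move=> B.
have code (S : subobject B) : exists k : subobject_code B,
    exists2 m : mono_into B, sval S = mono_equiv m &
      encodes (stable_repr (mono_map m)) k.
  case: S => S [m Sm] /=; have := @mono_monic _ _ m.
  rewrite -[mono_map m]stable_reprK => /(stable_reduction hR).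
  move=> [A0 [j [ev [sev lev iso_j]]]].
  by eexists; exists m => //; exists A0, j, ev; split.
have [g gP] := choice code.
have sval_eq (S T : subobject B) : sval S = sval T -> S = T.
  by case: S T => S exS [T exT]; apply: eq_exist.
(* A code determines the monomorphism up to [mono_equiv], hence the subobject. *)
apply: (injective_small (g := g)) => S T gST.
have [m Sm km] := gP S; have [n Tn] := gP T; rewrite -gST => kn.
apply: sval_eq; rewrite Sm Tn; apply: mono_equiv_eq.
have [h [iso_h]] := encodes_iso km kn.
by rewrite !stable_reprK => mn; exists h.
Qed.
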